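(* Consider an irreducible QBD process with finite or infinite phase space $\{0,\dots,m\}$ ($m\le\infty$), such that the continuous-time Markov chain on $\mathbb{Z}\times\{0,\dots,m\}$ which moves up one level, stays within a level, and moves down one level according to $Q_0,Q_1,Q_2$ respectively is irreducible, and such that there is a row vector $\mathbf{x}$ with $\mathbf{x}\mathbf{1}=1$, $\mathbf{x}(Q_0+Q_1+Q_2)=0$ and $\mathbf{x}Q_0\mathbf{1}<\mathbf{x}Q_2\mathbf{1}$. Let $P_k^K(i,j)$, $H$, $L_1$ and $\Sigma^*$ be as defined in the context, and let $c$ be the convergence norm of $L_1$. Then: (1) for each phase $i$ and each $j\in\Sigma^*$ there exists $k^*$ such that, for $k>k^*$, $$\lim_{K\to\infty}\frac{\log P_k^K(i,j)}{K}=\log(c);$$ (2) for $i,j\notin\Sigma^*$ (and given $k$) there exists $K^*$ such that $P_k^K(i,j)=0$ for all $K>K^*$; (3) for $i\in\Sigma^*$, $j\notin\Sigma^*$ and all $k<K$, $P_k^K(i,j)=0$.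
   Context: A (level-independent) QBD process is a continuous-time Markov chain $(Y_t,J_t)_{t\ge0}$ on $\{0,1,\dots\}\times\{0,\dots,m\}$ ($m$ finite or infinite; $Y_t$ is the level, $J_t$ the phase) with block tridiagonal generator: from level $k\ge0$ to level $k+1$ the block is $Q_0$; within level $k\ge1$ it is $Q_1$; from level $k\ge1$ to $k-1$ it is $Q_2$; within level $0$ it is $\widetilde{Q}_1$. The other blocks vanish. Here $\mathbf{1}$ is the column vector of ones. For $0\leq k<K$, $P_k^K(i,j)$ is the probability that, starting from state $(k,i)$ (level $k$, phase $i$), the process hits level $K$ before level $0$ and its phase at the first hitting time of level $K$ is $j$. Let $H_k=P_k^{k+1}$ for $k\ge1$. The matrices $H_1,H_2,\dots$ increase elementwise to $H$, the minimal nonnegative solution of $Q_0+Q_1H+Q_2H^2=0$. It is a standing fact of the paper that, after a suitable permutation of the phases, either $H$ is itself irreducible and aperiodic (then $L_1=H$ and $\Sigma^*$ is the set of all phases), or $$H=\begin{pmatrix}L_1&0\\ L_{.1}&L_{.}\end{pmatrix},$$ where $L_1$ is irreducible and aperiodic and $L_{.}$ is lower triangular with zero diagonal. $\Sigma^*$ denotes the set of phases indexing $L_1$. The convergence norm of a nonnegative irreducible aperiodic matrix $A$ is $\lim_{n\to\infty}(A^n(i,j))^{1/n}$, which does not depend on $i,j$ (it is the reciprocal of the common convergence radius of the power series $\sum_nA^n(i,j)z^n$). *)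

(* Defs.v *)
From HB Require Import structures.
From mathcomp Require Export all_boot all_order all_algebra.
From mathcomp Require Export all_classical all_reals all_analysis.
Export Order.TTheory GRing.Theory Num.Theory numFieldNormedType.Exports.

Set Implicit Arguments.
Unset Strict Implicit.
Unset Printing Implicit Defensive.

Local Open Scope classical_set_scope.
Local Open Scope ring_scope.

(** * Sums and matrices over a possibly infinite index set *)

(* [has_esum f s]: the unordered sum of the family f is well defined in the
   extended reals (not of the form oo - oo) and equals s.  When s is finite this
   is absolute summability. *)
Definition has_esum (R : realType) (I : choiceType) (f : I -> \bar R)
    (s : \bar R) : Prop :=
  let pos := (\esum_(i in [set: I]) (f^\+)%E i)%E in
  let neg := (\esum_(i in [set: I]) (f^\-)%E i)%E in
  (pos < +oo \/ neg < +oo)%E /\ s = (pos - neg)%E.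

(* Powers of a nonnegative matrix. *)
Fixpoint mpow (R : realType) (I : choiceType) (A : I -> I -> \bar R) (n : nat)
    (i j : I) : \bar R :=
  if n is n'.+1 then (\esum_(l in [set: I]) (A i l * mpow A n' l j))%E
  else ((i == j)%:R)%:E.

Definition irreducible_mx (R : realType) (I : choiceType)
    (A : I -> I -> \bar R) : Prop :=
  forall i j, exists n, (0 < n)%N /\ (0 < mpow A n i j)%E.

(* For every i, gcd {n >= 1 | A^n(i,i) > 0} = 1. *)
Definition aperiodic_mx (R : realType) (I : choiceType)
    (A : I -> I -> \bar R) : Prop :=
  forall (i : I) (d : nat),
    (forall n, (0 < n)%N -> (0 < mpow A n i i)%E -> (d %| n)%N) -> d = 1%N.

Definition is_convergence_norm (R : realType) (I : choiceType)
    (A : I -> I -> \bar R) (c : R) : Prop :=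
  forall i j, ((mpow A n i j `^ (n%:R^-1))%E @[n --> \oo] --> c%:E).

(** * Continuous-time Markov chains on a countable state space *)

(* Stable and conservative generators. *)
Definition is_generator (R : realType) (S : countType) (q : S -> S -> R) :
    Prop :=
  (forall s t, s != t -> 0 <= q s t) /\
  (forall s, (\esum_(t in [set t | t != s]) (q s t)%:E = (- q s s)%:E)%E).

Definition irreducible_gen (R : realType) (S : countType) (q : S -> S -> R) :
    Prop :=
  forall s t, exists p : seq S,
    path (fun a b => (a != b) && (0 < q a b)) s p /\ last s p = t.

Definition jump_prob (R : realType) (S : countType) (q : S -> S -> R)
    (s t : S) : R :=
  if s == t then 0 else q s t / (- q s s).

(* Jump chain / holding time description, for generators without absorbing
   states (q s s < 0 for all s): Z is the jump chain, D n the time spent in the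
   n-th visited state.  Given Z, the D n are independent and exponential with
   rates - q (Z n) (Z n).  X is the minimal process: it takes the value [None]
   from the explosion time sup_n (D 0 + ... + D n) on, if that is finite. *)
Definition is_CTMC (R : realType) (S : countType) (q : S -> S -> R) (s0 : S)
    (d : measure_display) (Omega : measurableType d) (P : probability Omega R)
    (X : R -> Omega -> option S) : Prop :=
  exists (Z : nat -> Omega -> S) (D : nat -> Omega -> R),
    [/\ forall n s, measurable [set w | Z n w = s],
        forall n, measurable_fun [set: Omega] (D n) /\ (forall w, 0 < D n w),
        forall (n : nat) (s : nat -> S) (t : nat -> R), (forall l, 0 <= t l) ->
          P [set w | forall l, (l <= n)%N -> Z l w = s l /\ t l < D l w] =
          ((s 0%N == s0)%:R *
           \prod_(l < n) jump_prob q (s l) (s l.+1) *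
           \prod_(l < n.+1) expR (q (s l) (s l) * t l))%:E,
        forall (n : nat) (t : R) (w : Omega),
          \sum_(l < n) D l w <= t < \sum_(l < n.+1) D l w ->
          X t w = Some (Z n w)
      & forall (t : R) (w : Omega), (forall n : nat, \sum_(l < n) D l w <= t) -> X t w = None].

(** * Quasi-birth-and-death processes *)

(* The phase space {0, ..., m}; [None] stands for m = oo. *)
Definition in_phase (m : option nat) : pred nat :=
  fun i => if m is Some n then (i <= n)%N else true.
Definition phase (m : option nat) : Type := {i : nat | in_phase m i}.
HB.instance Definition _ (m : option nat) := Countable.on (phase m).

Section QBD.
Variables (R : realType) (m : option nat).
Implicit Types Q : phase m -> phase m -> R.

Definition qbd_gen Q0 Q1 Q2 Q1t (s t : nat * phase m) : R :=
  if t.1 == s.1.+1 then Q0 s.2 t.2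
  else if t.1 == s.1 then (if s.1 == 0%N then Q1t s.2 t.2 else Q1 s.2 t.2)
  else if t.1.+1 == s.1 then Q2 s.2 t.2
  else 0.

(* The same transitions without boundary, on levels in Z. *)
Definition qbd_gen_int Q0 Q1 Q2 (s t : int * phase m) : R :=
  if t.1 == s.1 + 1 then Q0 s.2 t.2
  else if t.1 == s.1 then Q1 s.2 t.2
  else if t.1 == s.1 - 1 then Q2 s.2 t.2
  else 0.

(* x is a row vector with x1 = 1, x(Q0 + Q1 + Q2) = 0 and xQ0 1 < xQ2 1.
   The row sums Q0 1 and Q2 1 are finite for the blocks of a generator. *)
Definition downward_drift Q0 Q1 Q2 (x : phase m -> R) : Prop :=
  let rowsum Q i := fine (\esum_(j in [set: phase m]) (Q i j)%:E)%E in
  [/\ has_esum (fun i => (x i)%:E) 1%:E,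
      forall j, has_esum (fun i => (x i * (Q0 i j + Q1 i j + Q2 i j))%:E) 0%:E
    & exists a b : \bar R,
        [/\ has_esum (fun i => (x i * rowsum Q0 i)%:E) a,
            has_esum (fun i => (x i * rowsum Q2 i)%:E) b
          & (a < b)%E]].

Section hitting.
Context (d : measure_display) (Omega : measurableType d).
Variable Pr : nat * phase m -> probability Omega R.
Variable X : R -> Omega -> option (nat * phase m).

(* Level K is hit for the first time at some time t, in phase j, and level 0
   is not hit before t. *)
Definition hit_event (K : nat) (j : phase m) : set Omega :=
  [set w | exists t : R, [/\ 0 <= t, X t w = Some (K, j) &
     forall (u : R) s, 0 <= u < t -> X u w = Some s -> s.1 <> 0%N /\ s.1 <> K]].

(* [hit_prob k K i j] is P_k^K(i,j), for k < K. *)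
Definition hit_prob (k K : nat) (i j : phase m) : \bar R :=
  Pr (k, i) (hit_event K j).

(* The elementwise (increasing) limit of H_k = P_k^{k+1}. *)
Definition Hmx (i j : phase m) : \bar R :=
  limn (fun k => hit_prob k k.+1 i j).

End hitting.

Definition submx_on (A : phase m -> phase m -> \bar R) (Sigma : set (phase m))
    (i j : set_type Sigma) : \bar R := A (val i) (val j).

(* Sigma indexes the block L1 in the block form of A, the case Sigma = setT
   being that of an irreducible aperiodic A.  The injection r numbers the
   remaining phases so that their diagonal block is lower triangular with zero
   diagonal. *)
Definition is_Sigma_star (A : phase m -> phase m -> \bar R)
    (Sigma : set (phase m)) : Prop :=
  [/\ Sigma !=set0,
      irreducible_mx (@submx_on A Sigma) /\ aperiodic_mx (@submx_on A Sigma),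
      forall i j, Sigma i -> ~ Sigma j -> A i j = 0%E
    & exists r : phase m -> nat,
        {in ~` Sigma &, injective r} /\
        (forall i j, ~ Sigma i -> ~ Sigma j -> (r i <= r j)%N -> A i j = 0%E)].

End QBD.

(* Main.v *)
Require Import Defs.
From mathcomp Require Import zify lra.
Set Implicit Arguments.
Unset Strict Implicit.
Unset Printing Implicit Defensive.

Local Open Scope classical_set_scope.
Local Open Scope ring_scope.

(** Write [climb k K i j] for P_k^K(i,j), computed on the jump chain: it is the
    least nonnegative solution of the first-step equations, the supremum over n
    of the probability of success within n jumps.  Three facts carry the proof.

    - A climb from level k to level K passes through every level in between, so
      the climbs multiply like matrices ([climb_succ], [climb_superM]).
    - Shifting a climb up by one level moves the lethal level 0 further away, so
      [climb k (k + N)] increases with k ([climb_mono]); by monotone convergence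
      its limit is the matrix power H^N ([mpow_climb_limit]).
    - The level process on the integers is irreducible: a path from phase i to
      phase j at the same level, shifted far above level 0, shows that the climbs
      from i and from j differ by at most a constant factor, uniformly in the
      levels ([climb_compare]).

    Since P_k^K <= H^(K-k), parts (2) and (3) are read off the block triangular
    form of H.  For part (1), the comparison replaces i by j: the upper bound is
    P_k^K(i,j) <= C P_(k+b)^(K+b)(j,j) <= C H^(K-k)(j,j), and the right side has
    growth rate c.  For the lower bound, fix y < c.  Some power n satisfies
    H^n(j,j) > y^n, hence P_k'^(k'+n)(j,j) > y^n for all levels k' high enough;
    reaching such a level costs a positive factor which does not depend on K, and
    from there blocks of n levels are chained.  Whether that factor is positive
    depends on k only through a threshold which serves all y at once: [H^n(j,j)]
    is positive for all large n, and it is enough that finitely many of these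
    inequalities have become true for the climbs ([climb_growth]). *)

(** * Suprema of sequences and sums over arbitrary index sets *)

Definition esupn (R : realType) (u : nat -> \bar R) : \bar R :=
  ereal_sup (range u).

Section Suprema.
Context {R : realType}.
Local Open Scope ereal_scope.
Implicit Types u v : nat -> \bar R.

Lemma esupn_ge u n : u n <= esupn u.
Proof. by apply: ereal_sup_ubound; exists n. Qed.

Lemma esupn_le u y : (forall n, u n <= y) -> esupn u <= y.
Proof. by move=> uy; apply: ge_ereal_sup => _ [n _ <-]. Qed.

Lemma esupn_cvg u : (forall n, u n <= u n.+1) -> u @ \oo --> esupn u.
Proof.
by move=> ndu; apply: ereal_nondecreasing_cvgn; apply/nondecreasing_seqP.
Qed.

Lemma esupn_lt u y : y < esupn u -> exists n, y < u n.
Proof. by move=> /ereal_sup_gt[_ [n _ <-] yu]; exists n. Qed.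

Lemma esupnM u v :
  (forall n, 0 <= u n <= u n.+1) -> (forall n, 0 <= v n <= v n.+1) ->
  esupn u \is a fin_num -> esupn v \is a fin_num ->
  esupn (fun n => u n * v n) = esupn u * esupn v.
Proof.
move=> u0 v0 uf vf.
have uS n : u n <= u n.+1 by have /andP[] := u0 n.
have vS n : v n <= v n.+1 by have /andP[] := v0 n.
apply: (@cvg_unique _ (@ereal_hausdorff R) ((fun n => u n * v n) @ \oo)).
  apply: esupn_cvg => n; have /andP[? ?] := u0 n; have /andP[? ?] := v0 n.
  exact: lee_pmul.
apply: cvgeM; [|exact: esupn_cvg|exact: esupn_cvg].
exact: mule_def_fin.
Qed.

Lemma esupnZl (y : \bar R) u : 0 <= y -> (forall n, 0 <= u n <= u n.+1) ->
  esupn (fun n => y * u n) = y * esupn u.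
Proof.
move=> y0 u0; have uS n : u n <= u n.+1 by have /andP[] := u0 n.
have u_ge0 n : 0 <= u n by have /andP[] := u0 n.
have [yf|] := boolP (y \is a fin_num).
  apply: (@cvg_unique _ (@ereal_hausdorff R) ((fun n => y * u n) @ \oo)).
    by apply: esupn_cvg => n; rewrite lee_wpmul2l.
  by apply: cvgeZl => //; exact: esupn_cvg.
rewrite ge0_fin_numE// -leNgt leye_eq => /eqP ->.
apply/eqP; rewrite eq_le; apply/andP; split.
  by apply: esupn_le => n; rewrite lee_wpmul2l// esupn_ge.
have [[n un]|/forallNP un] := pselect (exists n, 0 < u n).
  rewrite (le_trans (leey _))// -[leLHS](gt0_mulye un).
  exact: (esupn_ge (fun n => +oo * u n)).
suff -> : esupn u = 0 by rewrite mule0 (le_trans _ (esupn_ge _ 0%N))// mule_ge0.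
apply/eqP; rewrite eq_le (le_trans (u_ge0 0%N) (esupn_ge _ _)) andbT.
by apply: esupn_le => n; rewrite leNgt; apply/negP/un.
Qed.
End Suprema.

Section Sums.
Context {R : realType} {I : choiceType}.
Local Open Scope ereal_scope.
Implicit Types f : I -> \bar R.

(** Monotone convergence for the counting measure: finite partial sums commute
    with increasing limits, and suprema commute. *)
Lemma esum_esupn (f : nat -> I -> \bar R) :
  (forall n i, 0 <= f n i <= f n.+1 i) ->
  \esum_(i in [set: I]) esupn (fun n => f n i) =
  esupn (fun n => \esum_(i in [set: I]) f n i).
Proof.
move=> f0; have fS i n : f n i <= f n.+1 i by have /andP[] := f0 n i.
have f_ge0 i n : 0 <= f n i by have /andP[] := f0 n i.
apply/eqP; rewrite eq_le; apply/andP; split; last first.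
  by apply: esupn_le => n; apply: le_esum => i _; exact: (esupn_ge (fun n => f n i)).
apply: ge_ereal_sup => _ [F [finF _] <-].
have cv : (fun n => \sum_(i \in F) f n i) @ \oo --> \sum_(i \in F) esupn (fun n => f n i).
  rewrite fsbig_finite//=; under eq_fun do rewrite fsbig_finite//=.
  apply: cvg_nnesum => // i _; first by apply: nearW => n; apply: f_ge0.
  exact: esupn_cvg.
rewrite -(cvg_lim _ cv)//; apply: lime_le; first by apply/cvg_ex; eexists; exact: cv.
apply: nearW => n; apply: le_trans (esupn_ge _ n).
by apply: ereal_sup_ubound; exists F.
Qed.

Lemma esum_ge1 f j : (forall i, 0 <= f i) -> f j <= \esum_(i in [set: I]) f i.
Proof.
move=> f0; apply: esum_ge; exists [set j]; last by rewrite fsbig_set1.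
by split => //; exact: finite_set1.
Qed.

Lemma esum_single f j : 0 <= f j -> (forall i, i != j -> f i = 0) ->
  \esum_(i in [set: I]) f i = f j.
Proof.
move=> f0 fj; rewrite -[RHS](@esum_set1 _ _ j)// [RHS]esum_mkcond.
apply: eq_esum => i _; rewrite in_set1; have [->|/fj] := eqVneq i j; by [].
Qed.

Lemma esum_eq0P f : (forall i, 0 <= f i) -> \esum_(i in [set: I]) f i = 0 ->
  forall i, f i = 0.
Proof. by move=> f0 s0 i; apply/eqP; rewrite eq_le f0 -s0 esum_ge1. Qed.

Lemma esumZl f (y : \bar R) : 0 <= y -> (forall i, 0 <= f i) ->
  \esum_(i in [set: I]) (y * f i) = y * \esum_(i in [set: I]) f i.
Proof.
move=> y0 f0.
have [f_eq0|] := eqVneq (\esum_(i in [set: I]) f i) 0.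
  rewrite f_eq0 mule0; apply: esum1 => i _.
  by rewrite (esum_eq0P f0 f_eq0) mule0.
move=> s_neq0; have s_gt0 : 0 < \esum_(i in [set: I]) f i.
  by rewrite lt_neqAle eq_sym s_neq0 esum_ge0.
apply/eqP; rewrite eq_le; apply/andP; split.
  apply: ge_ereal_sup => _ [F FI <-]; rewrite -ge0_mule_fsumr//.
  by apply: lee_wpmul2l => //; apply: ereal_sup_ubound; exists F.
have [/eqP|y_neq0] := boolP (y == 0).
  by move=> ->; rewrite mul0e; apply: esum_ge0 => i _; rewrite mul0e.
have y_gt0 : 0 < y by rewrite lt_neqAle eq_sym y_neq0.
case: y y0 y_neq0 y_gt0 => [y| |]// y0 y_neq0; last first.
  move=> _; rewrite gt0_mulye//.
  have [[i fi0]|/forallNP all0] := pselect (exists i, 0 < f i); last first.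
    move: s_neq0; rewrite esum1 ?eqxx// => i _; apply/eqP.
    by rewrite eq_le f0 leNgt andbT; apply/negP/all0.
  rewrite -[leLHS](gt0_mulye fi0).
  by apply: (@esum_ge1 (fun i => +oo * f i) i) => k; exact: mule_ge0.
rewrite lte_fin => y_gt0; rewrite -lee_pdivlMl//.
apply: ge_ereal_sup => _ [F FI <-]; rewrite lee_pdivlMl// ge0_mule_fsumr//.
by apply: ereal_sup_ubound; exists F.
Qed.

Lemma esumZr f (y : \bar R) : 0 <= y -> (forall i, 0 <= f i) ->
  \esum_(i in [set: I]) (f i * y) = (\esum_(i in [set: I]) f i) * y.
Proof.
by move=> y0 f0; rewrite muleC -esumZl//; apply: eq_esum => i _; rewrite muleC.
Qed.

Lemma le_esum_inj (J : choiceType) (e : J -> I) (f : J -> \bar R) (g : I -> \bar R) :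
  injective e -> (forall i, 0 <= g i) -> (forall j, f j <= g (e j)) ->
  \esum_(j in [set: J]) f j <= \esum_(i in [set: I]) g i.
Proof.
move=> e_inj g0 fg; apply: (@le_trans _ _ (\esum_(j in [set: J]) g (e j))).
  by apply: le_esum => j _; exact: fg.
rewrite -(@reindex_esum _ _ _ setT (range e) e g); last first.
  by split=> [j _|? ? _ _ /e_inj//|_ [j _ <-]]; exists j.
by rewrite esum_mkcond; apply: le_esum => i _; case: ifP.
Qed.

End Sums.

(** Tonelli for counting measures: both sides are the sum over the product. *)
Lemma esum_exchange {R : realType} {I J : choiceType} (a : I -> J -> \bar R) :
  (forall i j, 0 <= a i j)%E ->
  (\esum_(i in [set: I]) \esum_(j in [set: J]) a i j =
  \esum_(j in [set: J]) \esum_(i in [set: I]) a i j)%E.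
Proof.
move=> a0; rewrite !esum_esum//.
rewrite (reindex_esum (setT `*`` (fun=> setT)) _ (fun z : J * I => (z.2, z.1)))//.
split=> //=; first by move=> [i1 j1] [i2 j2] _ _ [-> ->].
by move=> [i j] _; exists (j, i).
Qed.

(** * Hitting probabilities of a discrete chain *)

Section Hitting.
Context {R : realType} {S : choiceType}.
Variables (p : S -> S -> R) (B : pred S).
Hypothesis p0 : forall s t, 0 <= p s t.
Local Open Scope ereal_scope.

(** The probability that the chain started at [s] enters the absorbing set [B]
    within [n] steps and does so at [t]. *)
Fixpoint hit_by (n : nat) (s t : S) : \bar R :=
  if B s then (s == t)%:R%:E
  else if n is n'.+1 then \esum_(u in [set: S]) ((p s u)%:E * hit_by n' u t)
  else 0.

Definition hit (s t : S) : \bar R := esupn (fun n => hit_by n s t).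

Lemma hit_byB n s t : B s -> hit_by n s t = (s == t)%:R%:E.
Proof. by case: n => [|n] /= ->. Qed.

Lemma hit_by0 s t : ~~ B s -> hit_by 0 s t = 0.
Proof. by move=> /= /negbTE ->. Qed.

Lemma hit_byS n s t : ~~ B s ->
  hit_by n.+1 s t = \esum_(u in [set: S]) ((p s u)%:E * hit_by n u t).
Proof. by move=> /= /negbTE ->. Qed.

Lemma hit_by_ge0 n s t : 0 <= hit_by n s t.
Proof.
elim: n s => [|n IHn] s; have [Bs|Bs] := boolP (B s).
- by rewrite hit_byB// lee_fin.
- by rewrite hit_by0.
- by rewrite hit_byB// lee_fin.
- by rewrite hit_byS//; apply: esum_ge0 => u _; rewrite mule_ge0 ?lee_fin.
Qed.

Lemma hit_by_leS n s t : hit_by n s t <= hit_by n.+1 s t.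
Proof.
elim: n s => [|n IHn] s; have [Bs|Bs] := boolP (B s).
- by rewrite !hit_byB.
- by rewrite hit_by0// hit_by_ge0.
- by rewrite !hit_byB.
- rewrite !hit_byS//; apply: le_esum => u _.
  by rewrite lee_wpmul2l ?lee_fin.
Qed.

Lemma hit_by_mono n s t : 0 <= hit_by n s t <= hit_by n.+1 s t.
Proof. by rewrite hit_by_ge0 hit_by_leS. Qed.

Lemma hit_by_le_hit n s t : hit_by n s t <= hit s t.
Proof. exact: (esupn_ge (fun n => hit_by n s t)). Qed.

Lemma hit_ge0 s t : 0 <= hit s t.
Proof. exact: le_trans (hit_by_ge0 0 s t) (hit_by_le_hit 0 s t). Qed.

Lemma hitB s t : B s -> hit s t = (s == t)%:R%:E.
Proof.
move=> Bs; apply/eqP; rewrite eq_le -{2}(hit_byB 0 t Bs) hit_by_le_hit andbT.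
by apply: esupn_le => n; rewrite hit_byB.
Qed.

Lemma hitE s t : ~~ B s ->
  hit s t = \esum_(u in [set: S]) ((p s u)%:E * hit u t).
Proof.
move=> Bs; transitivity (esupn (fun n => hit_by n.+1 s t)).
  apply/eqP; rewrite eq_le; apply/andP; split; apply: esupn_le => n.
    exact: le_trans (hit_by_leS n s t) (esupn_ge (fun n => hit_by n.+1 s t) n).
  exact: hit_by_le_hit.
rewrite (_ : (fun n => _) = (fun n =>
    \esum_(u in [set: S]) ((p s u)%:E * hit_by n u t))); last first.
  by apply/funext => n; rewrite hit_byS.
rewrite -esum_esupn; last first.
  move=> n u; rewrite mule_ge0 ?lee_fin ?hit_by_ge0//=.
  by rewrite lee_wpmul2l ?lee_fin ?hit_by_leS.
apply: eq_esum => u _; rewrite esupnZl ?lee_fin// => n.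
exact: hit_by_mono.
Qed.

Lemma hit_le1 s t : (forall s, \esum_(u in [set: S]) (p s u)%:E <= 1) -> hit s t <= 1.
Proof.
move=> p1; apply: esupn_le => n; elim: n s => [|n IHn] s; have [Bs|Bs] := boolP (B s).
- by rewrite hit_byB// lee_fin lern1 leq_b1.
- by rewrite hit_by0.
- by rewrite hit_byB// lee_fin lern1 leq_b1.
- rewrite hit_byS//; apply: le_trans (p1 s); apply: le_esum => u _.
  by rewrite -[leRHS]mule1 lee_wpmul2l ?lee_fin.
Qed.

Lemma hit_step s u t : ~~ B s -> (p s u)%:E * hit u t <= hit s t.
Proof.
move=> Bs; rewrite (hitE t Bs).
apply: (esum_ge1 u (f := fun u => (p s u)%:E * hit u t)) => v.
by rewrite mule_ge0 ?lee_fin ?hit_ge0.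
Qed.

End Hitting.

Section FirstPassage.
Context {R : realType} {S : choiceType}.
Variables (p : S -> S -> R) (B B' : pred S) (D : set S).
Hypothesis p0 : forall s t, 0 <= p s t.
Hypothesis Dp : forall s u, D s -> ~~ B' s -> p s u != 0 -> D u.
Hypothesis BB' : forall s, D s -> B s -> B' s.
Local Open Scope ereal_scope.

(** The strong Markov property at the entrance into [B'].  Inside the region
    [D], which the chain leaves only through [B'], the set [B'] is met before
    [B]; its points are the gates [e j] and points from which [t] is out of
    reach.  Both sides equal [hit p B _ t] on [B'] and satisfy the same linear
    equation off [B'], and each side is the least solution of its equation:
    hence an induction on the number of steps for either inequality. *)
Lemma hit_first_passage (J : choiceType) (e : J -> S) (t : S) s : injective e ->
  (forall s, D s -> B' s -> (exists j, s = e j) \/ hit p B s t = 0) ->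
  D s ->
  hit p B s t = \esum_(j in [set: J]) (hit p B' s (e j) * hit p B (e j) t).
Proof.
move=> e_inj gates Ds.
have hB0 := hit_ge0 B p0; have hB'0 := hit_ge0 B' p0.
have hn0 n u j : 0 <= hit_by p B' n u (e j) by exact: hit_by_ge0.
pose g v := \esum_(j in [set: J]) (hit p B' v (e j) * hit p B (e j) t).
have gB' v : D v -> B' v -> g v = hit p B v t.
  move=> Dv B'v; have [[j vE]|nv] := pselect (exists j, v = e j); last first.
    have [//|->] := gates _ Dv B'v; apply: esum1 => j _; rewrite hitB//.
    by have [vE|_] := eqVneq v (e j); [case: nv; exists j|rewrite mul0e].
  rewrite /g (esum_single (j := j)) ?mule_ge0//.
    by rewrite hitB// -vE eqxx mul1e.
  by move=> i ij; rewrite hitB// vE (inj_eq e_inj) eq_sym (negbTE ij) mul0e.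
have gE v : ~~ B' v -> g v = \esum_(u in [set: S]) ((p v u)%:E * g u).
  move=> B'v.
  transitivity (\esum_(j in [set: J]) \esum_(u in [set: S])
      ((p v u)%:E * hit p B' u (e j) * hit p B (e j) t)).
    apply: eq_esum => j _; rewrite hitE// esumZr// => u.
    by rewrite mule_ge0 ?lee_fin.
  rewrite esum_exchange; last by move=> j u; rewrite !mule_ge0 ?lee_fin.
  apply: eq_esum => u _; rewrite -esumZl ?lee_fin//.
    by apply: eq_esum => j _; rewrite muleA.
  by move=> j; rewrite mule_ge0.
rewrite -/(g s); apply/eqP; rewrite eq_le; apply/andP; split.
  suff le_by n v : D v -> hit_by p B n v t <= g v.
    by apply: esupn_le => n; exact: le_by.
  elim: n v => [|n IHn] v Dv; have [B'v|B'v] := boolP (B' v).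
  - by rewrite gB'// hit_by_le_hit.
  - rewrite hit_by0; first by apply: esum_ge0 => j _; rewrite mule_ge0.
    exact: contra (BB' Dv) B'v.
  - by rewrite gB'// hit_by_le_hit.
  - rewrite hit_byS; last exact: contra (BB' Dv) B'v.
    rewrite gE//; apply: le_esum => u _.
    have [->|pvu] := eqVneq (p v u) 0%R; first by rewrite !mul0e.
    by rewrite lee_wpmul2l ?lee_fin// IHn//; exact: Dp pvu.
suff le_by n v : D v -> \esum_(j in [set: J])
    (hit_by p B' n v (e j) * hit p B (e j) t) <= hit p B v t.
  rewrite /g (_ : (fun j => _) = (fun j => esupn (fun n =>
      hit p B (e j) t * hit_by p B' n s (e j)))); last first.
    by apply/funext => j; rewrite esupnZl// 1?muleC// => n; exact: hit_by_mono.
  rewrite esum_esupn; last first.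
    move=> n j; have /andP[h0 hS] := hit_by_mono B' p0 n s (e j).
    by rewrite mule_ge0//= lee_wpmul2l.
  apply: esupn_le => n; apply: le_trans (le_by n _ Ds).
  by apply: le_esum => j _; rewrite muleC.
have leB' k u : D u -> B' u -> \esum_(j in [set: J])
    (hit_by p B' k u (e j) * hit p B (e j) t) <= hit p B u t.
  move=> Du B'u; rewrite -gB'//; apply: le_esum => j _.
  by rewrite lee_wpmul2r// hit_by_le_hit.
elim: n v => [|n IHn] v Dv; have [B'v|B'v] := boolP (B' v); try exact: leB'.
  by rewrite esum1// => j _; rewrite hit_by0// mul0e.
rewrite [leRHS]hitE//; last exact: contra (BB' Dv) B'v.
rewrite (_ : (fun j => _) = (fun j => \esum_(u in [set: S])
    ((p v u)%:E * hit_by p B' n u (e j) * hit p B (e j) t))); last first.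
  apply/funext => j; rewrite hit_byS// esumZr// => u.
  by rewrite mule_ge0 ?lee_fin.
rewrite esum_exchange; last by move=> j u; rewrite !mule_ge0 ?lee_fin.
apply: le_esum => u _.
have [->|pvu] := eqVneq (p v u) 0%R.
  by rewrite mul0e esum1// => j _; rewrite !mul0e.
under eq_esum do rewrite -muleA.
rewrite esumZl ?lee_fin//; last by move=> j; rewrite mule_ge0.
by rewrite lee_wpmul2l ?lee_fin// IHn//; exact: Dp pvu.
Qed.
End FirstPassage.

(** * Hitting events of a random sequence with Markovian law *)

Section DiscreteRV.
Context (R : realType) (S : countType) (d : measure_display)
  (Omega : measurableType d) (P : probability Omega R).

Lemma measurable_discrete (Z : Omega -> S) (Q : S -> Prop) :
  (forall s, measurable [set w | Z w = s]) -> measurable [set w | Q (Z w)].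
Proof.
move=> mZ; rewrite (_ : [set w | _] =
    \bigcup_s (if `[< Q s >] then [set w | Z w = s] else set0)).
  apply: countable_bigcupT_measurable; first exact: countableP.
  by move=> s; case: ifP => _; [exact: mZ|exact: measurable0].
apply/seteqP; split=> [w Qw|w [s _]]; last by case: asboolP => // Qs /= ->.
by exists (Z w) => //; case: asboolP.
Qed.

Lemma probability_discrete (Z : Omega -> S) (A : set Omega) :
  (forall s, measurable [set w | Z w = s]) -> measurable A ->
  P A = (\esum_(s in [set: S]) P (A `&` [set w | Z w = s]))%E.
Proof.
move=> mZ mA; pose F (n : nat) := A `&` [set w | pickle (Z w) = n].
have mF n : measurable (F n).
  apply: measurableI => //.
  exact: (@measurable_discrete Z (fun s : S => pickle s = n)).
have -> : P A = P (\bigcup_n F n).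
  congr (P _); apply/seteqP; split=> [w Aw|w [n _ []]//].
  by exists (pickle (Z w)).
rewrite measure_bigcup//; last first.
  by move=> n m _ _ [w [[_ <-] [_ <-]]].
rewrite (eq_eseriesl (Q := xpredT)); last by move=> n; rewrite in_setT.
rewrite nneseries_esumT//.
have FE s : F (pickle s) = A `&` [set w | Z w = s].
  apply/seteqP; split=> [w [Aw /= /(pcan_inj pickleK)]//|w [Aw /= <-]//].
apply/eqP; rewrite eq_le; apply/andP; split; last first.
  by apply: (le_esum_inj (pcan_inj pickleK)) => // s; rewrite FE.
rewrite (_ : (\esum_(i in _) _)%E = (\esum_(i in range (@pickle S)) P (F i))%E).
  rewrite (@reindex_esum _ S nat setT (range pickle) pickle); last first.
    split=> [s _|? ? _ _ /(pcan_inj pickleK)//|_ [s _ <-]]; by exists s.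
  by apply: le_esum => s _; rewrite FE.
rewrite [RHS]esum_mkcond; apply: eq_esum => n _; case: ifPn => //.
move=> /negP nn; rewrite (_ : F n = set0) ?measure0//.
apply/seteqP; split=> // w [_ /= zn]; apply: nn.
by rewrite inE /=; exists (Z w).
Qed.

End DiscreteRV.

Section ChainHitting.
Context (R : realType) (S : countType) (d : measure_display)
  (Omega : measurableType d) (P : probability Omega R).
Variables (p : S -> S -> R) (s0 : S) (Z : nat -> Omega -> S).
Hypothesis p0 : forall s t, 0 <= p s t.
Hypothesis mZ : forall n s, measurable [set w | Z n w = s].
Hypothesis lawZ : forall (n : nat) (s : nat -> S),
  P [set w | forall l, (l <= n)%N -> Z l w = s l] =
  ((s 0%N == s0)%:R * \prod_(l < n) p (s l) (s l.+1))%:E.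
Variables (B : pred S) (t : S).
Hypothesis Bt : B t.

(** The event behind [hit_by], unfolded in the same way, for the sequence [Z]
    observed from time [m] on. *)
Fixpoint reach_by (n m : nat) (w : Omega) : bool :=
  if B (Z m w) then Z m w == t
  else if n is n'.+1 then reach_by n' m.+1 w else false.

Lemma measurable_reach_by n m : measurable [set w | reach_by n m w].
Proof.
elim: n m => [|n IHn] m /=.
  exact: (measurable_discrete (fun z => if B z then z == t else false)).
rewrite (_ : [set w | _] = [set w | B (Z m w) /\ Z m w = t] `|`
    ([set w | ~~ B (Z m w)] `&` [set w | reach_by n m.+1 w])).
  apply: measurableU; last apply: measurableI => //.
    exact: (measurable_discrete (fun z => B z /\ z = t)).
  exact: (measurable_discrete (fun z => ~~ B z)).
apply/seteqP; split=> w /=; case: (B (Z m w)) => //=.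
- by move/eqP; left.
- by right.
- by move=> [[_ ->]//|[]//].
- by move=> [[]//|[]//].
Qed.

Lemma reach_byP w :
  (exists n, reach_by n 0 w) <->
  (exists n, Z n w = t /\ forall l, (l < n)%N -> ~~ B (Z l w)).
Proof.
split=> [[n]|[n [Zn Bl]]].
- suff H m : (forall l, (l < m)%N -> ~~ B (Z l w)) -> reach_by n m w ->
      exists n, Z n w = t /\ forall l, (l < n)%N -> ~~ B (Z l w).
    exact: H.
  elim: n m => [|n IHn] m mB /=; have [Bm|Bm] := boolP (B (Z m w)) => //.
  + by move=> /eqP Zm; exists m.
  + by move=> /eqP Zm; exists m.
  + apply: IHn => l; rewrite ltnS leq_eqVlt => /predU1P[->//|]; exact: mB.
- exists n; suff H k m : (m + k = n)%N -> reach_by k m w by exact: H.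
  elim: k m => [|k IHk] m /= mk.
    by rewrite addn0 in mk; rewrite mk Zn Bt eqxx.
  rewrite (negbTE (Bl m _)) ?IHk// -mk; lia.
Qed.

Lemma reach_by_leS n m w : reach_by n m w -> reach_by n.+1 m w.
Proof.
elim: n m => [|n IHn] m; rewrite [reach_by _.+1 _ _]/=; first by rewrite /=; case: ifP.
by rewrite /=; case: ifP => // _; exact: IHn.
Qed.

Let cyl (m : nat) (s : nat -> S) := [set w | forall l, (l <= m)%N -> Z l w = s l].

Lemma cylS m s u : cyl m s `&` [set w | Z m.+1 w = u] =
  cyl m.+1 (fun l => if l == m.+1 then u else s l).
Proof.
apply/seteqP; split=> [w [ws wu] l|w ws].
  rewrite leq_eqVlt => /predU1P[->|]; first by rewrite eqxx.
  by rewrite ltnS => lm; rewrite ltn_eqF ?ltnS//; exact: ws.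
split=> [l lm|]; last by rewrite /= (ws m.+1) ?eqxx.
by rewrite (ws l) ?leqW// ltn_eqF.
Qed.

Lemma measurable_cyl m s : measurable (cyl m s).
Proof.
rewrite (_ : cyl m s = \bigcap_(l in [set l | (l <= m)%N]) [set w | Z l w = s l]).
  by apply: bigcap_measurable => [|l _]; [exists 0%N|exact: mZ].
by apply/seteqP; split.
Qed.

(** The Markov property: conditioned on the first [m] steps, the future is a
    chain started at [s m].  The induction prolongs the observed past by one step
    at a time, so that only the law of finite cylinders is used. *)
Lemma prob_cyl_reach n m s :
  P (cyl m s `&` [set w | reach_by n m w]) = (P (cyl m s) * hit_by p B n (s m) t)%E.
Proof.
have cB k v i : B (v i) -> P (cyl i v `&` [set w | reach_by k i w]) =
    (P (cyl i v) * hit_by p B k (v i) t)%E.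
  move=> Bv; rewrite hit_byB//.
  have rE w : cyl i v w -> reach_by k i w = (v i == t).
    by move=> /(_ i (leqnn _)) vi; case: k => [|k]; rewrite /= vi Bv.
  have [vt|vt] := eqVneq (v i) t; last first.
    rewrite mule0 (_ : _ `&` _ = set0) ?measure0//; apply/seteqP; split=> // w.
    by move=> [/rE /= ->]; rewrite (negbTE vt).
  rewrite mule1; congr (P _); apply/seteqP; split=> [w []//|w cw]; split=> //=.
  by rewrite rE// vt.
elim: n m s => [|n IHn] m s; have [Bs|Bs] := boolP (B (s m)); try exact: cB.
  rewrite hit_by0// mule0 (_ : _ `&` _ = set0) ?measure0//; apply/seteqP; split=> // w.
  by move=> [/(_ m (leqnn _)) /= ->]; rewrite (negbTE Bs).
rewrite hit_byS// -esumZl//; last first.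
  by move=> u; rewrite mule_ge0 ?lee_fin// hit_by_ge0.
rewrite (probability_discrete _ (mZ m.+1)); last first.
  apply: measurableI; [exact: measurable_cyl|exact: measurable_reach_by].
apply: eq_esum => u _.
pose v l := if l == m.+1 then u else s l.
transitivity (P (cyl m.+1 v `&` [set w | reach_by n m.+1 w])).
  rewrite -cylS; congr (P _); apply/seteqP; split=> w.
    by move=> [[cw]] /=; rewrite (cw m (leqnn _)) (negbTE Bs).
  by move=> [[cw zu] rw]; do !split=> //=; rewrite (cw m (leqnn _)) (negbTE Bs).
rewrite IHn {2}/v eqxx muleA; congr (_ * _)%E.
rewrite !lawZ big_ord_recr /= {1}/v /= -EFinM -mulrA; congr ((_ * (_ * _))%:E).
  by apply: eq_bigr => i _; rewrite /v !ltn_eqF ?ltnS// ltnW.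
by rewrite /v eqxx ltn_eqF.
Qed.

Lemma prob_hit :
  P [set w | exists n, Z n w = t /\ forall l, (l < n)%N -> ~~ B (Z l w)] =
  hit p B s0 t.
Proof.
have mF n := measurable_reach_by n 0.
rewrite (_ : [set w | _] = \bigcup_n [set w | reach_by n 0 w]); last first.
  apply/seteqP; split=> [w /reach_byP[n nw]|w [n _ nw]]; first by exists n.
  by apply/reach_byP; exists n.
apply: (@cvg_unique _ (@ereal_hausdorff R) (P \o (fun n => [set w | reach_by n 0 w]) @ \oo)).
  apply: nondecreasing_cvg_mu => //; first exact: bigcupT_measurable.
  by apply/nondecreasing_seqP => n; apply/subsetPset => w /=; exact: reach_by_leS.
rewrite (_ : P \o _ = (fun n => hit_by p B n s0 t)); last first.
  apply/funext => n /=; rewrite (probability_discrete _ (mZ 0))//.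
  rewrite (_ : (fun s => _) = (fun s => (s == s0)%:R%:E * hit_by p B n s t)%E).
    rewrite (esum_single (j := s0)); first by rewrite eqxx mul1e.
      by rewrite mule_ge0 ?lee_fin ?hit_by_ge0.
    by move=> s /negbTE ->; rewrite mul0e.
  apply/funext => s; transitivity (P (cyl 0 (fun=> s)) * hit_by p B n s t)%E.
    rewrite -(prob_cyl_reach n 0 (fun=> s)) setIC; congr (P (_ `&` _)).
    apply/seteqP; split=> [w zw l|w /(_ 0)]; last exact.
    by rewrite leqn0 => /eqP ->.
  by rewrite lawZ big_ord0 mulr1.
apply: esupn_cvg => n; exact: hit_by_leS.
Qed.
End ChainHitting.

(** * From the continuous-time process to its jump chain *)

Section JumpChain.
Context (R : realType) (m : option nat).
Variables (q : nat * phase m -> nat * phase m -> R).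
Context (d : measure_display) (Omega : measurableType d).

Definition boundary (K : nat) : pred (nat * phase m) :=
  fun s => (s.1 == 0%N) || (s.1 == K).

Section Path.
Variables (X : R -> Omega -> option (nat * phase m)).
Variables (Z : nat -> Omega -> nat * phase m) (D : nat -> Omega -> R).
Hypothesis D_gt0 : forall n w, 0 < D n w.
Hypothesis X_Z : forall (n : nat) (t : R) (w : Omega),
  \sum_(l < n) D l w <= t < \sum_(l < n.+1) D l w -> X t w = Some (Z n w).
Hypothesis X_None : forall (t : R) (w : Omega),
  (forall n : nat, \sum_(l < n) D l w <= t) -> X t w = None.

Let T n w := \sum_(l < n) D l w.

Lemma jump_time_lt n w : T n w < T n.+1 w.
Proof. by rewrite /T big_ord_recr /= ltrDl. Qed.

Lemma jump_time_le n k w : (n <= k)%N -> T n w <= T k w.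
Proof.
move=> nk; apply: (@nondecreasing_seqP _ _ (T ^~ w)).1 nk => l.
exact/ltW/jump_time_lt.
Qed.

Lemma jump_interval t w n : 0 <= t -> t < T n w ->
  exists2 l, (l < n)%N & T l w <= t < T l.+1 w.
Proof.
move=> t0; elim: n => [|n IHn] tn; first by move: tn; rewrite /T big_ord0 ltNge t0.
have [nt|tn'] := leP (T n w) t; first by exists n; rewrite ?nt.
by have [l ln lt] := IHn tn'; exists l; rewrite // ltnW.
Qed.

(** Every time lies in a holding interval or after the explosion, and the
    process is constant on the former and undefined on the latter; hence the
    event is determined by the jump chain for every outcome, not just almost
    surely. *)
Lemma hit_eventE K j : hit_event X K j = [set w | exists n,
  Z n w = (K, j) /\ forall l, (l < n)%N -> ~~ boundary K (Z l w)].
Proof.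
apply/seteqP; split=> w /=.
  move=> [t [t0 Xt Xu]].
  have [n tn] : exists n, t < T n w.
    apply: contrapT => /forallNP tn; move: Xt; rewrite X_None// => n.
    by rewrite leNgt; apply/negP/tn.
  have [l ln lt] := jump_interval t0 tn.
  move: Xt; rewrite (X_Z lt) => -[Zl]; exists l; split=> // k kl.
  have Tk : 0 <= T k w < t.
    have := @jump_time_le 0 k w (leq0n k); rewrite {1}/T big_ord0 => ->.
    have /andP[+ _] := lt; apply: lt_le_trans.
    exact: lt_le_trans (jump_time_lt k w) (jump_time_le _ _).
  have [|Z0 ZK] := Xu (T k w) (Z k w) Tk.
    by apply: X_Z; rewrite lexx; exact: jump_time_lt.
  by rewrite /boundary negb_or; apply/andP; split; exact/eqP.
move=> [n [Zn Bl]]; exists (T n w); split.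
- by have := @jump_time_le 0 n w (leq0n n); rewrite {1}/T big_ord0.
- by rewrite -Zn; apply: X_Z; rewrite lexx; exact: jump_time_lt.
- move=> u s /andP[u0 un]; have [l ln lu] := jump_interval u0 un.
  rewrite (X_Z lu) => -[<-]; have := Bl _ ln; rewrite /boundary negb_or.
  by move=> /andP[/eqP Z0 /eqP ZK].
Qed.
End Path.

Lemma hit_probE (Pr : nat * phase m -> probability Omega R)
  (X : R -> Omega -> option (nat * phase m)) k K i j :
  (forall s t, 0 <= jump_prob q s t) ->
  is_CTMC q (k, i) (Pr (k, i)) X ->
  hit_prob Pr X k K i j = hit (jump_prob q) (boundary K) (k, i) (K, j).
Proof.
move=> p0 [Z [D [mZ mD lawZ X_Z X_None]]].
have D_gt0 n w : 0 < D n w by have [_] := mD n.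
rewrite /hit_prob (hit_eventE D_gt0 X_Z X_None).
apply: prob_hit => //; last by rewrite /boundary /= eqxx orbT.
(* Holding times are positive: the threshold 0 leaves the law of Z alone. *)
move=> n s; have := lawZ n s (fun=> 0) (fun l => lexx 0).
rewrite [X in _ * X]big1; last by move=> l _; rewrite mulr0 expR0.
rewrite mulr1 => <-; congr (Pr _ _); apply/seteqP; split=> w ws l ln.
  by split; [exact: ws|exact: D_gt0].
by have [] := ws l ln.
Qed.

End JumpChain.

(** * Powers of nonnegative matrices *)

Section MatrixPowers.
Context {R : realType} {I : choiceType}.
Variable A : I -> I -> \bar R.
Hypothesis A0 : forall i j, (0 <= A i j)%E.
Local Open Scope ereal_scope.

Lemma mpow_ge0 n i j : 0 <= mpow A n i j.
Proof.
elim: n i => [|n IHn] i /=; first by rewrite lee_fin.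
by apply: esum_ge0 => l _; exact: mule_ge0.
Qed.

Lemma mpow_superM n k i l j :
  mpow A n i l * mpow A k l j <= mpow A (n + k) i j.
Proof.
elim: n i => [|n IHn] i /=.
  by have [->|_] := eqVneq i l; rewrite ?mul1e// mul0e mpow_ge0.
rewrite -esumZr ?mpow_ge0//; last by move=> u; rewrite mule_ge0 ?mpow_ge0.
by apply: le_esum => u _; rewrite -muleA lee_wpmul2l.
Qed.

Lemma mpow_superX n q j : mpow A n j j ^+ q <= mpow A (n * q) j j.
Proof.
elim: q => [|q IHq]; first by rewrite muln0 /= eqxx.
rewrite mulnS expeS; apply: le_trans (mpow_superM n _ j j j).
by rewrite lee_wpmul2l ?mpow_ge0.
Qed.
End MatrixPowers.

Section BlockTriangular.
Context {R : realType} {m : option nat}.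
Variables (A : phase m -> phase m -> \bar R) (Sigma : set (phase m)).
Hypothesis A0 : forall i j, (0 <= A i j)%E.
Hypothesis closed : forall i j, Sigma i -> ~ Sigma j -> A i j = 0%E.
Local Open Scope ereal_scope.

Lemma mpow_closed n i j : Sigma i -> ~ Sigma j -> mpow A n i j = 0.
Proof.
elim: n i => [|n IHn] i Si Sj /=.
  by have [ij|//] := eqVneq i j; move: Sj; rewrite -ij.
apply: esum1 => l _; have [Sl|Sl] := pselect (Sigma l).
  by rewrite IHn// mule0.
by rewrite closed// mul0e.
Qed.

Lemma mpow_submx n (i j : set_type Sigma) :
  mpow (@submx_on R m A Sigma) n i j = mpow A n (val i) (val j).
Proof.
elim: n i => [|n IHn] i /=; first by rewrite val_eqE.
apply/eqP; rewrite eq_le; apply/andP; split.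
  apply: (le_esum_inj val_inj) => [l|l]; last by rewrite IHn.
  by rewrite mule_ge0// mpow_ge0.
transitivity (\esum_(l in Sigma) (A (val i) l * mpow A n l (val j)) <=
   \esum_(l in [set: set_type Sigma]) (submx_on A i l * mpow (@submx_on R m A Sigma) n l j)).
  congr (_ <= _); rewrite [RHS]esum_mkcond; apply: eq_esum => l _.
  case: ifPn => //; rewrite notin_setE => Sl.
  by rewrite closed ?mul0e//; exact: set_valP.
rewrite (@reindex_esum _ _ _ [set: set_type Sigma] Sigma val).
  by apply: le_esum => l _; rewrite IHn.
split=> [l _|? ? _ _ /val_inj//|l Sl]; first exact: set_valP.
by exists (SigSub (mem_set Sl)).
Qed.

(** Off [Sigma] every step strictly decreases [r], so a path of more than [r i]
    steps must enter [Sigma], which it cannot leave. *)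
Lemma mpow_nilpotent (r : phase m -> nat) n i j :
  (forall i j, ~ Sigma i -> ~ Sigma j -> (r i <= r j)%N -> A i j = 0) ->
  ~ Sigma i -> ~ Sigma j -> (r i < n)%N -> mpow A n i j = 0.
Proof.
move=> rA; elim: n i => [//|n IHn] i Si Sj rin /=.
apply: esum1 => l _; have [Sl|Sl] := pselect (Sigma l).
  by rewrite mpow_closed// mule0.
have [ril|rli] := leqP (r i) (r l); first by rewrite rA// mul0e.
by rewrite IHn ?mule0//; lia.
Qed.
End BlockTriangular.

(** * Climbing probabilities of a QBD process *)

Section QBD.
Context {R : realType} {m : option nat}.
Variables (Q0 Q1 Q2 Q1t : phase m -> phase m -> R).
Hypothesis hgen : is_generator (qbd_gen Q0 Q1 Q2 Q1t).
Let q := qbd_gen Q0 Q1 Q2 Q1t.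
Let p := jump_prob q.
Local Open Scope ereal_scope.

Lemma gen_exit_ge s u : s != u -> (q s u <= - q s s)%R.
Proof.
move=> su; have [q0 qE] := hgen; rewrite -lee_fin -qE.
rewrite -(@esum_set1 _ _ u (fun u => (q s u)%:E)) ?lee_fin ?q0//.
rewrite [leLHS]esum_mkcond [leRHS]esum_mkcond; apply: le_esum => v _.
rewrite in_set1; have [->|_] := eqVneq v u; first by rewrite mem_set//= eq_sym.
by case: ifPn => // /set_mem /= vs; rewrite lee_fin q0// eq_sym.
Qed.

Lemma jump_ge0 s t : (0 <= p s t)%R.
Proof.
rewrite /p /jump_prob; have [//|st] := eqVneq s t.
have q0 : (0 <= q s t)%R by have [q0 _] := hgen; exact: q0.
by rewrite divr_ge0// (le_trans q0) ?gen_exit_ge.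
Qed.
Hint Resolve jump_ge0 : core.

Lemma jump_sum_le1 s : \esum_(t in [set: nat * phase m]) (p s t)%:E <= 1.
Proof.
have [q0 qE] := hgen.
have qss : (0 <= - q s s)%R.
  by rewrite -lee_fin -qE esum_ge0// => t /= ts; rewrite lee_fin q0// eq_sym.
rewrite (_ : \esum_(t in _) _ = (- q s s)%:E * (- q s s)^-1%:E).
  by rewrite -EFinM lee_fin; have [->|/divff ->] := eqVneq (- q s s)%R 0%R; rewrite ?mul0r.
rewrite -qE [in RHS]esum_mkcond -esumZr ?lee_fin ?invr_ge0//; last first.
  by move=> t; case: ifPn => // /set_mem /= ts; rewrite lee_fin q0// eq_sym.
apply: eq_esum => t _; rewrite /p /jump_prob.
have [->|ts] := eqVneq s t; first by rewrite memNset ?mul0e//= eqxx.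
by rewrite mem_set//= eq_sym.
Qed.

Lemma jump_shift a b i j : (0 < a)%N -> p (a, i) (b, j) = p (a.+1, i) (b.+1, j).
Proof. by case: a => // a _; rewrite /p /jump_prob !xpair_eqE !eqSS /q /qbd_gen /= !eqSS. Qed.

Lemma jump_level_le s t : p s t != 0%R -> (t.1 <= s.1.+1)%N.
Proof.
rewrite /p /jump_prob; have [_|_] := eqVneq s t; first by rewrite eqxx.
rewrite mulf_eq0 negb_or => /andP[+ _]; rewrite /q /qbd_gen.
case: (t.1 =P s.1.+1) => [->//|_]; case: (t.1 =P s.1) => [->//|_].
by case: (t.1.+1 =P s.1) => [<- _|]; [lia|rewrite eqxx].
Qed.

Definition climb (k K : nat) (i j : phase m) : \bar R :=
  hit p (boundary K) (k, i) (K, j).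

Lemma climb_ge0 k K i j : 0 <= climb k K i j.
Proof. exact: hit_ge0. Qed.
Hint Resolve climb_ge0 : core.

Lemma climb_le1 k K i j : climb k K i j <= 1.
Proof. exact: hit_le1 jump_sum_le1. Qed.

Lemma climb0 k i j : climb k k i j = (i == j)%:R%:E.
Proof. by rewrite /climb hitB /boundary ?eqxx ?orbT// xpair_eqE eqxx. Qed.

Lemma climb_succ k K i j : (k < K)%N -> climb k K i j =
  \esum_(l in [set: phase m]) (climb k k.+1 i l * climb k.+1 K l j).
Proof.
move=> kK; rewrite /climb.
apply: (@hit_first_passage _ _ _ (boundary K) (boundary k.+1) [set s | (s.1 <= k.+1)%N]) => //=.
- move=> [a l] [b l'] /= ak; rewrite /boundary negb_or => /andP[_ ak1] /jump_level_le /=.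
  by move: ak1 => /=; lia.
- by move=> [a l] /= ak; rewrite /boundary /=; lia.
- by move=> l l' [].
- move=> [a l] /= ak; rewrite /boundary /= => /orP[a0|/eqP ->]; last by left; exists l.
  right; rewrite hitB /boundary ?a0// xpair_eqE.
  by rewrite (_ : a == K = false)//; lia.
Qed.

(** One level higher, the lethal level is one step further away while all
    transitions between interior levels are the same. *)
Lemma climb_shift k K i j : (0 < K)%N -> climb k K i j <= climb k.+1 K.+1 i j.
Proof.
move=> K0; apply: esupn_le => n.
elim: n k i => [|n IHn] k i; have [Bk|Bk] := boolP (boundary K (k, i)).
- rewrite hit_byB//; move: Bk; rewrite /boundary /= => /orP[/eqP->|/eqP ->].
    by rewrite xpair_eqE eq_sym (gtn_eqF K0).
  by rewrite climb0 xpair_eqE eqxx.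
- by rewrite hit_by0.
- rewrite hit_byB//; move: Bk; rewrite /boundary /= => /orP[/eqP->|/eqP ->].
    by rewrite xpair_eqE eq_sym (gtn_eqF K0).
  by rewrite climb0 xpair_eqE eqxx.
- have Bk1 : ~~ boundary K.+1 (k.+1, i).
    by move: Bk; rewrite /boundary /= !negb_or eqSS => /andP[].
  rewrite hit_byS// /climb hitE//.
  apply: (@le_esum_inj _ _ _ (fun u => (u.1.+1, u.2))) => //.
  + by move=> [a l] [b l'] /= [-> ->].
  + by move=> u; rewrite mule_ge0 ?lee_fin// hit_ge0.
  + move=> [b l] /=; rewrite -jump_shift; last first.
      by move: Bk; rewrite /boundary /= negb_or lt0n => /andP[].
    by rewrite lee_wpmul2l ?lee_fin// IHn.
Qed.

Lemma climb_mono N k k' i j : (k <= k')%N -> climb k (k + N) i j <= climb k' (k' + N) i j.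
Proof.
move=> kk'; rewrite -(subnK kk'); elim: (k' - k)%N => [//|d IHd].
apply: le_trans IHd _; case: N => [|N]; first by rewrite !addn0 !climb0.
by rewrite !addSn climb_shift// addnS.
Qed.

(** Only an inequality is claimed because a single phase [l] is prescribed at
    the intermediate level. *)
Lemma climb_superM k k' K i l j : (k <= k' <= K)%N ->
  climb k k' i l * climb k' K l j <= climb k K i j.
Proof.
move=> /andP[kk']; rewrite -(subnK kk') addnC; move: (k' - k)%N => N {kk' k'}.
elim: N k i => [|N IHN] k i kNK.
  by rewrite addn0 climb0; have [->|_] := eqVneq i l; rewrite ?mul1e ?mul0e.
rewrite (climb_succ i l); last lia.
rewrite (climb_succ i j); last lia.
rewrite -esumZr//; last by move=> u; rewrite mule_ge0.
apply: le_esum => u _; rewrite -muleA lee_wpmul2l//.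
rewrite -addSnnS; apply: IHN; lia.
Qed.

(** The matrix H. *)
Definition climb_limit i j := esupn (fun k => climb k k.+1 i j).

Lemma climb_limit_ge0 i j : 0 <= climb_limit i j.
Proof. exact: le_trans (esupn_ge (fun k => climb k k.+1 i j) 0). Qed.

(** The factors of the climb H_k H_(k+1) ... H_(k+N-1) all tend to H as k grows,
    and monotone convergence passes the limit through the infinite sums. *)
Lemma mpow_climb_limit N i j :
  mpow climb_limit N i j = esupn (fun k => climb k (k + N) i j).
Proof.
have mono n a b k : 0 <= climb k (k + n) a b <= climb k.+1 (k.+1 + n) a b.
  by rewrite climb_ge0 climb_mono.
have fin n a b : esupn (fun k => climb k (k + n) a b) \is a fin_num.
  rewrite ge0_fin_numE; last exact: le_trans (esupn_ge (fun k => climb k (k + n) a b) 0).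
  by apply: (@le_lt_trans _ _ 1); [apply: esupn_le => k; exact: climb_le1|rewrite ltry].
elim: N i => [|N IHN] i /=.
  apply/eqP; rewrite eq_le; apply/andP; split.
    apply: le_trans (esupn_ge (fun k => climb k (k + 0) i j) 0).
    by rewrite climb0.
  by apply: esupn_le => k; rewrite addn0 climb0.
rewrite (_ : (fun k => _) = (fun k => \esum_(l in [set: phase m])
   (climb k (k + 1) i l * climb k.+1 (k.+1 + N) l j))); last first.
  by apply/funext => k; rewrite (climb_succ i j) ?addn1 ?addSnnS//; lia.
rewrite -esum_esupn; last first.
  move=> k l; have /andP[? ?] := mono 1%N i l k; have /andP[? ?] := mono N l j k.+1.
  by rewrite mule_ge0//= lee_pmul.
apply: eq_esum => l _; rewrite IHN.
have -> : climb_limit i l = esupn (fun k => climb k (k + 1) i l).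
  by congr esupn; apply/funext => k; rewrite addn1.
have -> : esupn (fun k => climb k (k + N) l j) =
    esupn (fun k => climb k.+1 (k.+1 + N) l j).
  apply/eqP; rewrite eq_le; apply/andP; split; apply: esupn_le => k.
    have /andP[_ h] := mono N l j k; apply: le_trans h _.
    exact: (esupn_ge (fun k => climb k.+1 (k.+1 + N) l j)).
  exact: (esupn_ge (fun k => climb k (k + N) l j)).
have finS : esupn (fun k => climb k.+1 (k.+1 + N) l j) \is a fin_num.
  rewrite ge0_fin_numE; last exact: le_trans (esupn_ge (fun k => climb k.+1 (k.+1 + N) l j) 0).
  by apply: (@le_lt_trans _ _ 1); [apply: esupn_le => k; exact: climb_le1|rewrite ltry].
by apply/esym/esupnM => // k; exact: mono.
Qed.

Lemma climb_le_mpow k N i j : climb k (k + N) i j <= mpow climb_limit N i j.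
Proof. by rewrite mpow_climb_limit; exact: (esupn_ge (fun k => climb k (k + N) i j)). Qed.

Section Comparison.
Hypothesis hirrZ : irreducible_gen (qbd_gen_int Q0 Q1 Q2).
Let qZ := qbd_gen_int Q0 Q1 Q2.

Lemma qbd_gen_intE (k a b : nat) (s u : int * phase m) :
  (0 < a)%N -> a%:Z = (k%:Z + s.1)%R -> b%:Z = (k%:Z + u.1)%R ->
  q (a, s.2) (b, u.2) = qZ s u.
Proof.
move=> a0 ak bk; rewrite /q /qbd_gen /qZ /qbd_gen_int /= (gtn_eqF a0).
have -> : (b == a.+1) = (u.1 == s.1 + 1)%R by lia.
have -> : (b == a) = (u.1 == s.1)%R by lia.
by have -> : (b.+1 == a) = (u.1 == s.1 - 1)%R by lia.
Qed.

(** Following a path costs the product of its transition probabilities.  The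
    bound [b] makes every step of the shifted path start strictly between the
    levels 0 and [K], where these probabilities do not depend on the level; so
    the cost [e] is the same for all [k] and [K]. *)
Lemma climb_along_path (s : int * phase m) (pth : seq (int * phase m)) :
  path (fun a b => (a != b) && (0 < qZ a b)%R) s pth ->
  exists b (e : R), (0 < e)%R /\ forall (k K a a' : nat) t, (b < k)%N -> (k + b < K)%N ->
    a%:Z = (k%:Z + s.1)%R -> a'%:Z = (k%:Z + (last s pth).1)%R ->
    e%:E * hit p (boundary K) (a', (last s pth).2) t <=
    hit p (boundary K) (a, s.2) t.
Proof.
elim: pth s => [|u pth IHp] s /=.
  move=> _; exists 0%N, 1%R; split=> // k K a a' t _ _ ak a'k.
  by rewrite mul1e (_ : a' = a)//; lia.
move=> /andP[/andP[su qsu] /IHp[b [e [e0 eP]]]].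
(* b exceeds the absolute value of s.1, so k + s.1 lies between 1 and K - 1. *)
exists (b + `|s.1|%N.+1)%N, ((qZ s u / - Q1 s.2 s.2) * e)%R.
have uE : (u.1 == s.1 + 1)%R || (u.1 == s.1)%R || (u.1 == s.1 - 1)%R.
  move: qsu; rewrite /qZ /qbd_gen_int.
  by do 3 case: (_ == _) => //=; rewrite ltxx.
have step k a a1 : a%:Z = (k%:Z + s.1)%R -> (0 < a)%N -> a1%:Z = (k%:Z + u.1)%R ->
    p (a, s.2) (a1, u.2) = (qZ s u / - Q1 s.2 s.2)%R /\ (0 < qZ s u / - Q1 s.2 s.2)%R.
  move=> ak a0 a1k.
  have aa1 : (a, s.2) != (a1, u.2).
    apply: contra su => /eqP[aa1 s2u2]; rewrite -pair_eqE /pair_eq /= s2u2 eqxx andbT.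
    by apply/eqP; lia.
  have qE := qbd_gen_intE a0 ak a1k.
  have qss : q (a, s.2) (a, s.2) = Q1 s.2 s.2.
    by rewrite /q /qbd_gen /= eqxx (gtn_eqF a0) ltn_eqF.
  split; first by rewrite /p /jump_prob (negbTE aa1) qE qss.
  by rewrite divr_gt0// -qss (lt_le_trans qsu)// -qE gen_exit_ge.
(* Positivity does not involve the level; it is read off at a high one. *)
have e'0 : (0 < qZ s u / - Q1 s.2 s.2)%R.
  have [_] := step `|s.1|.+2 (absz (`|s.1|.+2%:Z + s.1)%R)
    (absz (`|s.1|.+2%:Z + u.1)%R) ltac:(lia) ltac:(lia) ltac:(lia).
  by [].
split; first exact: mulr_gt0.
move=> k K a a' t bk kK ak a'k.
have [pE _] := step k a (absz (k%:Z + u.1)%R) ak ltac:(lia) ltac:(lia).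
rewrite EFinM -muleA -pE.
apply: le_trans (hit_step (p := p) jump_ge0 _ _ _); last first.
  by rewrite /boundary /=; lia.
apply: lee_wpmul2l; first by rewrite lee_fin.
by apply: (eP k K) => //; lia.
Qed.

Lemma climb_compare i j : exists b (e : R), (0 < e)%R /\ forall k K l,
  (b < k)%N -> (k + b < K)%N -> e%:E * climb k K j l <= climb k K i l.
Proof.
have [pth [pthP lst]] := hirrZ (0%R, i) (0%R, j).
have [b [e [e0 eP]]] := climb_along_path pthP.
exists b, e; split=> // k K l bk kK; move: (eP k K k k (K, l) bk kK).
by rewrite lst /= addr0; exact.
Qed.
End Comparison.
End QBD.

(** * Exponential growth rates of real sequences *)

Section GrowthRates.
Context {R : realType}.
Implicit Types (u b : nat -> R) (c y : R).

Lemma exprn_powR_inv (x : R) n : 0 <= x -> (0 < n)%N ->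
  (x `^ n%:R^-1) ^+ n = x.
Proof.
move=> x0 n0; rewrite -powR_mulrn ?powR_ge0// -powRrM mulVf ?powRr1//.
by rewrite pnatr_eq0 -lt0n.
Qed.

Section RootTest.
Variables (b : nat -> R) (c : R).
Hypothesis b0 : forall n, 0 <= b n.
Hypothesis bc : (b n `^ n%:R^-1) @[n --> \oo] --> c.

Lemma root_limit_ge0 : 0 <= c.
Proof.
have <- := cvg_lim (@Rhausdorff R) bc.
apply: limr_ge; first by apply/cvg_ex; exists c.
by apply: nearW => n; exact: powR_ge0.
Qed.

Lemma root_limit_lt y : 0 <= y -> y < c -> \forall n \near \oo, y ^+ n < b n.
Proof.
move=> y0 yc.
have near_lt : \forall n \near \oo, y < b n `^ n%:R^-1 by exact: (cvgr_gt c).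
near=> n.
have n0 : (0 < n)%N by near: n; exact: nbhs_infty_gt.
have ynb : y < b n `^ n%:R^-1 by near: n.
rewrite -[ltRHS](exprn_powR_inv (b0 _) n0).
by rewrite ltrXn2r ?nnegrE ?powR_ge0// -lt0n.
Unshelve. all: by end_near. Qed.

Lemma root_limit_gt y : c < y -> \forall n \near \oo, b n <= y ^+ n.
Proof.
move=> cy; have y0 : 0 <= y by rewrite (le_trans root_limit_ge0)// ltW.
have near_lt : \forall n \near \oo, b n `^ n%:R^-1 < y by exact: (cvgr_lt c).
near=> n.
have n0 : (0 < n)%N by near: n; exact: nbhs_infty_gt.
have ynb : b n `^ n%:R^-1 < y by near: n.
rewrite -[leLHS](exprn_powR_inv (b0 _) n0).
by rewrite lerXn2r ?nnegrE ?powR_ge0// ltW.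
Unshelve. all: by end_near. Qed.

(** Supermultiplicativity bounds the roots [b (n * q) `^ (n * q)^-1] from below
    by the positive number [b n `^ n^-1]. *)
Lemma root_limit_gt0 n : (forall q, b n ^+ q <= b (n * q)%N) ->
  (0 < n)%N -> 0 < b n -> 0 < c.
Proof.
move=> superX n0 bn; rewrite lt_neqAle root_limit_ge0 andbT eq_sym.
apply/negP => /eqP c0.
pose x := b n `^ n%:R^-1; have x0 : 0 < x by rewrite powR_gt0.
have c_lt : c < x / 2 by rewrite c0 divr_gt0.
have [M _ bM] := root_limit_gt c_lt.
have Mn : (M <= n * M.+1)%N by nia.
have := le_trans (superX M.+1) (bM _ Mn); apply/negP; rewrite -ltNge.
rewrite exprM ltrXn2r ?nnegrE ?exprn_ge0 ?divr_ge0 ?b0 ?ltW//.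
rewrite -[ltRHS](exprn_powR_inv (b0 _) n0) ltrXn2r -?lt0n ?divr_ge0 ?ltW//.
by rewrite ltr_pdivrMr// ltr_pMr// ltr1n.
Qed.
End RootTest.

(** A gain of [y ^+ n] in [n] steps propagates the bound from the finitely many
    starting points in [k, k + n), one for each residue modulo [n]. *)
Lemma geometric_lower_bound (f : nat -> R) (n k : nat) y : (0 < n)%N -> 0 < y ->
  (forall K, (k <= K)%N -> 0 < f K) ->
  (forall K, (k <= K)%N -> f K * y ^+ n <= f (K + n)%N) ->
  exists2 e, 0 < e & forall K, (k <= K)%N -> e * y ^+ K <= f K.
Proof.
move=> n0 y0 f0 fn.
have [e e0 eP] : exists2 e, 0 < e &
    forall K, (k <= K < k + n)%N -> e * y ^+ K <= f K.
  elim: {n0 fn} n => [|n [e e0 eP]]; first by exists 1 => // K; rewrite addn0; lia.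
  exists (Num.min e (f (k + n)%N / y ^+ (k + n))).
    by rewrite lt_min e0 divr_gt0 ?exprn_gt0 ?f0// leq_addr.
  move=> K kKn; have [->|Kn] : K = (k + n)%N \/ (k <= K < k + n)%N by lia.
    by rewrite -ler_pdivlMr ?exprn_gt0// ge_min lexx orbT.
  by apply: le_trans (eP K Kn); rewrite ler_wpM2r ?exprn_ge0 ?(ltW y0)// ge_min lexx.
exists e => // K; elim/ltn_ind: K => K IHK kK.
have [Kn|nK] := ltnP K (k + n); first by apply: eP; rewrite kK.
rewrite -(@subnK n K); last lia.
apply: le_trans (fn _ _); last lia.
by rewrite exprD mulrA ler_wpM2r ?exprn_ge0 ?(ltW y0)// IHK; lia.
Qed.

Lemma cvg_ln_div u c : 0 < c ->
  (forall y, c < y -> exists2 M, 0 < M & \forall K \near \oo, u K <= M * y ^+ K) ->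
  (forall y, 0 < y < c -> exists2 e, 0 < e & \forall K \near \oo, e * y ^+ K <= u K) ->
  (ln (u K) / K%:R) @[K --> \oo] --> ln c.
Proof.
move=> c0 upper lower; apply/cvgrPdist_le => e e0.
have e2 : 0 < e / 2 by rewrite divr_gt0.
have const_small M : \forall K \near \oo, `|ln M / K%:R| <= e / 2 :> R.
  near=> K.
  have K0 : (0 < K)%N by near: K; exact: nbhs_infty_gt.
  rewrite normrM normfV (ger0_norm (ler0n _ K)) ler_pdivrMr ?ltr0n//.
  rewrite mulrC -ler_pdivrMr//; near: K; exact: nbhs_infty_ger.
have [M M0 uM] := upper (c * expR (e / 2)) ltac:(by rewrite ltr_pMr// expR_gt1).
have [d d0 du] := lower (c * expR (- (e / 2)))
  ltac:(by rewrite mulr_gt0 ?expR_gt0//= gtr_pMr// expR_lt1 oppr_lt0).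
have lnE M' z K : 0 < M' -> (0 < K)%N ->
    ln (M' * (c * expR z) ^+ K) / K%:R = ln M' / K%:R + ln c + z.
  move=> M'0 K0; have K0' : K%:R != 0 :> R by rewrite pnatr_eq0 -lt0n.
  rewrite lnM ?posrE ?exprn_gt0 ?mulr_gt0 ?expR_gt0// lnXn ?mulr_gt0 ?expR_gt0//.
  rewrite lnM ?posrE ?expR_gt0// expRK mulrDl -(mulr_natr (ln c + z)) mulfK//.
  by rewrite addrA.
near=> K.
have K0 : (0 < K)%N by near: K; exact: nbhs_infty_gt.
have KR : (0 : R) < K%:R by rewrite ltr0n.
have uK : u K <= M * (c * expR (e / 2)) ^+ K by near: K.
have dK : d * (c * expR (- (e / 2))) ^+ K <= u K by near: K.
have MK : `|ln M / K%:R| <= e / 2 by near: K; exact: const_small.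
have dK' : `|ln d / K%:R| <= e / 2 by near: K; exact: const_small.
have low0 : 0 < d * (c * expR (- (e / 2))) ^+ K.
  by rewrite mulr_gt0 ?exprn_gt0 ?mulr_gt0 ?expR_gt0.
have u0 : 0 < u K := lt_le_trans low0 dK.
have l1 : ln (u K) / K%:R <= ln M / K%:R + ln c + e / 2.
  rewrite -lnE// ler_pM2r ?invr_gt0// ler_ln ?posrE//.
  by rewrite mulr_gt0 ?exprn_gt0 ?mulr_gt0 ?expR_gt0.
have l2 : ln d / K%:R + ln c - e / 2 <= ln (u K) / K%:R.
  by rewrite -lnE// ler_pM2r ?invr_gt0// ler_ln ?posrE.
move: MK dK' l1 l2; rewrite !ler_norml.
move: (ln M / _) (ln d / _) (ln (u K) / _) (ln c) => a1 a2 a3 a4.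
move=> /andP[? ?] /andP[? ?] ? ?; apply/andP; split; lra.
Unshelve. all: by end_near. Qed.

End GrowthRates.

(** * The growth rate of the climbing probabilities *)

Section ClimbGrowth.
Context {R : realType} {m : option nat}.
Variables (Q0 Q1 Q2 Q1t : phase m -> phase m -> R).
Hypothesis hgen : is_generator (qbd_gen Q0 Q1 Q2 Q1t).
Hypothesis hirrZ : irreducible_gen (qbd_gen_int Q0 Q1 Q2).
Let climb := climb Q0 Q1 Q2 Q1t.
Let H := climb_limit Q0 Q1 Q2 Q1t.

Let U k K i j : R := fine (climb k K i j).

Lemma climbE k K i j : climb k K i j = (U k K i j)%:E.
Proof.
rewrite /U fineK// ge0_fin_numE ?climb_ge0//.
exact: le_lt_trans (climb_le1 hgen k K i j) (ltry _).
Qed.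

Lemma fine_climb_superM k k' K i l j : (k <= k' <= K)%N ->
  U k k' i l * U k' K l j <= U k K i j.
Proof. by move=> kK; rewrite -lee_fin EFinM -!climbE climb_superM. Qed.

(** The threshold [kstar] collects two requirements: that [k] lies above the
    paths used to compare [i] with [j], and that the climbs from [(k, j)] to
    [(k + n, j)] have positive probability for all large [n]. *)
Lemma climb_growth i j (c : R) :
  (mpow H n j j `^ (n%:R^-1))%E @[n --> \oo] --> c%:E ->
  (exists n, (0 < n)%N /\ (0 < mpow H n j j)%E) ->
  exists kstar, forall k, (kstar < k)%N ->
    ((lne (climb k K i j) * (K%:R^-1)%:E)%E @[K --> \oo] --> lne c%:E).
Proof.
pose b n : R := fine (mpow H n j j).
have H0 : forall i j, (0 <= H i j)%E := climb_limit_ge0 hgen.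
have powE n : mpow H n j j = (b n)%:E.
  rewrite /b fineK// ge0_fin_numE ?mpow_ge0//; apply: (@le_lt_trans _ _ 1%E).
    by rewrite mpow_climb_limit//; apply: esupn_le => k; exact: climb_le1.
  exact: ltry.
have b0 n : 0 <= b n by rewrite -lee_fin -powE mpow_ge0.
have U_le_b k n : U k (k + n) j j <= b n.
  by rewrite -lee_fin -powE -climbE climb_le_mpow.
have b_lt n y : y < b n -> exists k, y < U k (k + n) j j.
  rewrite -lte_fin -powE mpow_climb_limit// => /esupn_lt[k yk].
  by exists k; rewrite -lte_fin -climbE.
have U_mono n k k' a : (k <= k')%N -> U k (k + n) a j <= U k' (k' + n) a j.
  by move=> kk'; rewrite -lee_fin -!climbE climb_mono.
have U0 k K a : 0 <= U k K a j by rewrite -lee_fin -climbE climb_ge0.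
under eq_fun do rewrite powE poweR_EFin.
move=> /fine_cvg /= bc [n1 [n1_gt0 bn1]].
have c0 : 0 < c.
  apply: (root_limit_gt0 b0 bc) n1_gt0 _ => [q|]; last by rewrite -lte_fin -powE.
  by rewrite -lee_fin EFin_expe -!powE mpow_superX.
have [bij [eij [eij0 cmp_ij]]] := climb_compare hgen hirrZ i j.
have [bji [eji [eji0 cmp_ji]]] := climb_compare hgen hirrZ j i.
(* The limit c is positive, so b n vanishes for finitely many n only. *)
have [N [N0 bN]] : exists N, (0 < N)%N /\ forall n, (N <= n)%N -> 0 < b n.
  have [N _ bN] := root_limit_lt b0 bc (lexx 0) c0.
  exists N.+1; split=> // n Nn; have := bN n (ltnW Nn).
  by rewrite /= expr0n; case: n Nn {bN}.
have [k1 k1P] : exists k1, forall k n, (k1 <= k)%N -> (N <= n)%N -> 0 < U k (k + n) j j.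
  (* Each n >= N is a sum of numbers in [N, 2N), so finitely many levels need
     to be compared. *)
  have [k1 k1P] : exists k1, forall n, (N <= n < N + N)%N -> 0 < U k1 (k1 + n) j j.
    elim: {3}N => [|M [k1 k1P]]; first by exists 0%N => n; rewrite addn0; lia.
    have [k2 k2P] := b_lt _ _ (bN (N + M)%N (leq_addr _ _)).
    exists (maxn k1 k2) => n nM.
    have [->|nM'] : n = (N + M)%N \/ (N <= n < N + M)%N by lia.
      exact: lt_le_trans k2P (U_mono _ _ _ _ (leq_maxr _ _)).
    exact: lt_le_trans (k1P _ nM') (U_mono _ _ _ _ (leq_maxl _ _)).
  exists k1 => k n; elim/ltn_ind: n k => n IHn k kk1 Nn.
  have [nN|nN] := ltnP n (N + N).
    by apply: lt_le_trans (k1P n _) (U_mono _ _ _ _ kk1); rewrite Nn.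
  apply: lt_le_trans (fine_climb_superM (k' := k + N) _ j _ _); last lia.
  rewrite mulr_gt0//; first by apply: lt_le_trans (k1P N _) (U_mono _ _ _ _ kk1); lia.
  rewrite (_ : k + n = (k + N) + (n - N))%N; last lia.
  by apply: IHn; lia.
exists (maxn k1 bij) => k; rewrite gtn_max => /andP[kk1 kb].
have Upos K : (k + N <= K)%N -> 0 < U k K j j.
  move=> kK; rewrite (_ : K = k + (K - k))%N; last lia.
  by apply: k1P; lia.
have cmp K : (k + bij < K)%N -> eij * U k K j j <= U k K i j.
  by move=> kK; rewrite -lee_fin EFinM -!climbE cmp_ij.
have U_pos : \forall K \near \oo, 0 < U k K i j.
  exists (k + bij + N).+1 => // K /= kK.
  by apply: lt_le_trans (cmp K _); [rewrite mulr_gt0// Upos//; lia|lia].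
have growth : (ln (U k K i j) / K%:R) @[K --> \oo] --> ln c.
  apply: cvg_ln_div => // y.
    move=> cy; have [M _ bM] := root_limit_gt b0 bc cy.
    have y0 : 0 < y := lt_trans c0 cy.
    exists (eji^-1 * y ^- k); first by rewrite mulr_gt0 ?invr_gt0 ?exprn_gt0.
    exists (k + M + bji).+1 => // K /= kK.
    rewrite -mulrA ler_pdivlMl//.
    have -> : y ^- k * y ^+ K = y ^+ (K - k).
      rewrite -{1}(@subnKC k K); last lia.
      by rewrite exprD mulKf// expf_neq0// gt_eqF.
    apply: le_trans (bM (K - k)%N _); last by rewrite /=; lia.
    apply: le_trans (U_le_b (k + bji.+1)%N _).
    apply: (@le_trans _ _ (eji * U (k + bji.+1)%N ((k + bji.+1) + (K - k)) i j)).
      rewrite ler_pM2l// {1}(_ : K = k + (K - k))%N; last lia.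
      by apply: U_mono; lia.
    by rewrite -lee_fin EFinM -!climbE cmp_ji//; lia.
  move=> /andP[y0 yc]; have [M _ yM] := root_limit_lt b0 bc (ltW y0) yc.
  have [k0 k0P] := b_lt _ _ (yM M.+1 (leqnSn M)).
  have [e e0 eP] : exists2 e, 0 < e &
      forall K, (k0 + k + N <= K)%N -> e * y ^+ K <= U k K j j.
    apply: (geometric_lower_bound (n := M.+1)) => // K kK.
      by apply: Upos; lia.
    apply: le_trans (fine_climb_superM (k' := K) _ j _ _); last lia.
    rewrite ler_wpM2l// (le_trans (ltW k0P))//; apply: U_mono; lia.
  exists (eij * e); first exact: mulr_gt0.
  exists (k0 + k + N + bij).+1 => // K /= kK.
  apply: le_trans (cmp K _); last lia.
  by rewrite -mulrA ler_pM2l// eP//; lia.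
have lneE K : 0 < U k K i j ->
    (lne (climb k K i j) * (K%:R^-1)%:E = (ln (U k K i j) / K%:R)%:E)%E.
  by move=> UK; rewrite climbE lne_EFin.
rewrite leNgt c0 /=; apply: cvg_EFin.
  by near=> K; rewrite lneE//; near: K; exact: U_pos.
apply: cvg_trans growth; apply: near_eq_cvg.
by near=> K; rewrite /= lneE//; near: K; exact: U_pos.
Unshelve. all: by end_near. Qed.

End ClimbGrowth.

Theorem theorem7p3 (R : realType) (m : option nat)
  (Q0 Q1 Q2 Q1t : phase m -> phase m -> R)
  (hgen : is_generator (qbd_gen Q0 Q1 Q2 Q1t))
  (hirr : irreducible_gen (qbd_gen Q0 Q1 Q2 Q1t))
  (hirrZ : irreducible_gen (qbd_gen_int Q0 Q1 Q2))
  (x : phase m -> R) (hx : downward_drift Q0 Q1 Q2 x)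
  (d : measure_display) (Omega : measurableType d)
  (Pr : nat * phase m -> probability Omega R)
  (X : R -> Omega -> option (nat * phase m))
  (hX : forall s, is_CTMC (qbd_gen Q0 Q1 Q2 Q1t) s (Pr s) X)
  (Sigma : set (phase m)) (hSigma : is_Sigma_star (Hmx Pr X) Sigma)
  (c : R) (hc : is_convergence_norm (@submx_on R m (Hmx Pr X) Sigma) c) :
  [/\ forall i j, Sigma j ->
        exists kstar : nat, forall k, (kstar < k)%N ->
          ((lne (hit_prob Pr X k K i j) * (K%:R^-1)%:E)%E @[K --> \oo]
             --> lne c%:E),
      forall i j, ~ Sigma i -> ~ Sigma j -> forall k : nat,
        exists Kstar : nat, forall K, (Kstar < K)%N -> (k < K)%N ->
          hit_prob Pr X k K i j = 0%E
    & forall i j, Sigma i -> ~ Sigma j -> forall k K : nat, (k < K)%N ->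
        hit_prob Pr X k K i j = 0%E].
Proof.
pose climb := climb Q0 Q1 Q2 Q1t; pose H := climb_limit Q0 Q1 Q2 Q1t.
have hitE k K i j : hit_prob Pr X k K i j = climb k K i j.
  by apply: hit_probE => //; exact: jump_ge0.
have HE : Hmx Pr X = H.
  apply/funext => i; apply/funext => j; apply: cvg_lim => //.
  rewrite (_ : (fun k => _) = (fun k => climb k k.+1 i j)); last first.
    by apply/funext => k; exact: hitE.
  by apply: esupn_cvg => k; exact: (climb_shift hgen).
rewrite {}HE in hSigma hc.
have H0 : forall i j, (0 <= H i j)%E := climb_limit_ge0 hgen.
have [_ [irrL _] closed [r [_ rH]]] := hSigma.
have climb_eq0 k K i j : (k < K)%N -> mpow H (K - k) i j = 0%E -> climb k K i j = 0%E.
  move=> kK pow0; apply/eqP; rewrite eq_le climb_ge0// andbT -pow0.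
  by rewrite -{1}(subnKC (ltnW kK)) climb_le_mpow.
split=> [i j Sj|i j Si Sj k|i j Si Sj k K kK].
- pose j' : set_type Sigma := SigSub (mem_set Sj).
  have powE n : mpow H n j j = mpow (@submx_on R m H Sigma) n j' j'.
    by rewrite (mpow_submx H0 closed).
  have [kstar kP] : exists kstar, forall k, (kstar < k)%N ->
      ((lne (climb k K i j) * (K%:R^-1)%:E)%E @[K --> \oo] --> lne c%:E).
    apply: climb_growth => //.
      by under eq_fun do rewrite powE; exact: hc.
    by have [n nP] := irrL j' j'; exists n; rewrite powE.
  exists kstar => k /kP; apply: cvg_trans; apply: near_eq_cvg.
  by apply: nearW => K; rewrite hitE.
- exists (k + r i)%N => K rK kK; rewrite hitE climb_eq0//.
  by apply: (mpow_nilpotent closed rH) => //; lia.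
- by rewrite hitE climb_eq0// (mpow_closed closed).
Qed.
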